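(* Let $M\in\mathbb{N}$ and $\beta\in\big(1,\frac{1+\sqrt5}{2}\big)$. Then every $x\in\big(0,\frac{M}{\beta-1}\big)$ admits a simply normal $\beta$-expansion, that is, there exists $(a_i)\in\{0,\ldots,M\}^{\mathbb{N}}$ with $\sum_{i=1}^\infty \frac{a_i}{\beta^i}=x$ such that $(a_i)$ is simply normal.
   Context: $\mathbb{N}=\{1,2,3,\ldots\}$. For $(a_i)\in\{0,\ldots,M\}^{\mathbb{N}}$ and $k\in\{0,\ldots,M\}$, the $k$-frequency is $\mathrm{freq}_k(a_i)=\lim_{N\to\infty}\frac{\#\{1\le i\le N:a_i=k\}}{N}$, when the limit exists. The sequence $(a_i)$ is simply normal if for each $k\in\{0,\ldots,M\}$ the $k$-frequency exists and equals $\frac{1}{M+1}$. *)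

(* Defs.v *)
From mathcomp Require Import all_boot all_order all_algebra.
From mathcomp Require Import all_classical all_reals all_analysis.

Set Implicit Arguments.
Unset Strict Implicit.
Unset Printing Implicit Defensive.

Import Order.TTheory GRing.Theory Num.Theory.
Import numFieldNormedType.Exports.

Local Open Scope classical_set_scope.
Local Open Scope ring_scope.

(* Digit sequences are indexed from 0: a_i (i >= 1) is [a i.-1], so that the
   first N digits are those of index i < N, and [a i] has weight beta^-(i+1). *)

Definition is_beta_expansion (R : realType) (M : nat) (beta x : R)
    (a : nat -> 'I_M.+1) : Prop :=
  series (fun i : nat => (a i : nat)%:R / beta ^+ i.+1) @ \oo --> x.

Definition freq_ratio (R : realType) (M : nat) (a : nat -> 'I_M.+1)
    (k : 'I_M.+1) (N : nat) : R :=
  #|[set i : 'I_N | a i == k]%SET|%:R / N%:R.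

(* [limn] is total; it is the k-frequency only when [freq_ratio] converges. *)
Definition freq (R : realType) (M : nat) (a : nat -> 'I_M.+1)
    (k : 'I_M.+1) : R :=
  limn (freq_ratio R a k).

Definition simply_normal (R : realType) (M : nat) (a : nat -> 'I_M.+1) : Prop :=
  forall k : 'I_M.+1,
    cvgn (freq_ratio R a k) /\ freq R a k = (M.+1%:R)^-1.

(* Main.v *)
Require Import Defs.
From mathcomp Require Import all_boot all_order all_algebra.
From mathcomp Require Import all_classical all_reals all_analysis.
From mathcomp Require Import zify ring lra.

Import Order.TTheory GRing.Theory Num.Theory.
Import numFieldNormedType.Exports.

Local Open Scope classical_set_scope.
Local Open Scope ring_scope.

(** A finite word of digits d_1 ... d_n acts on the line by composing the maps
    y |-> beta y - d, and [a] is an expansion of [x] exactly when the orbit of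
    [x] under the digits of [a] stays in [0, M/(beta-1)].  So one has to steer
    an orbit inside that interval while keeping the digit counts under control.

    Two facts make this possible. First, any point away from the two ends can
    be sent into any prescribed interval of length at least 1 between them, in
    a number of steps that is fixed in advance ([reach]), because the preimages
    of such an interval under the M+1 digit maps overlap. Secondly, for two
    digits p < q, a point strictly between the fixed points of their maps can
    be kept there for ever by the digits p and q alone, with the difference
    between the numbers of p's and q's bounded ([balanced_word]). This is where
    beta < (1 + sqrt 5)/2 enters: it makes the interval bounded by the two
    points with periodic expansions (pq)^oo and (qp)^oo lie strictly inside the
    region where both digits may be played. In that interval the digit that is
    ahead is played; the way back is then made with the other digit, and a
    multiplicative invariant ([balanced]) shows that the lead stays bounded.

    Going once round the cyclic pairs (p, p+1), with n steps for each pair and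
    a bounded number of steps to travel from a pair to the next, every digit
    belongs to two pairs and is hence used n times up to a bounded error
    ([cycle_word]).  Concatenating these cycles for n = 1, 2, 3, ... gives an
    expansion: after m cycles its length is of order m^2 and its discrepancy of
    order m, so that all frequencies are 1/(M+1) ([concatenation],
    [simply_normal_of_discrepancy]). *)

Section Expansions.

Set Implicit Arguments.
Unset Strict Implicit.

Variables (R : realType) (M : nat) (beta : R).
Hypotheses (beta_gt1 : 1 < beta) (beta_golden : beta ^+ 2 < beta + 1).
Hypothesis M_gt0 : (0 < M)%N.

Implicit Types (x y u v : R) (d k p q : 'I_M.+1) (w : seq 'I_M.+1) (n : nat).

(** * Words of digits acting on the line *)

Definition step y d : R := beta * y - (d : nat)%:R.
Definition run y w : R := foldl step y w.
Definition fixpt d : R := (d : nat)%:R / (beta - 1).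

(** The largest number with an expansion, namely the fixed point of the digit M. *)
Definition top : R := M%:R / (beta - 1).

Lemma run_cat y w1 w2 : run y (w1 ++ w2) = run (run y w1) w2.
Proof. exact: foldl_cat. Qed.

Lemma run_rcons y w d : run y (rcons w d) = step (run y w) d.
Proof. by rewrite -cats1 run_cat. Qed.

Lemma digit_fixpt d : (d : nat)%:R = (beta - 1) * fixpt d.
Proof. by rewrite /fixpt mulrC divfK// subr_eq0 gt_eqF. Qed.

Lemma top_fixpt : M%:R = (beta - 1) * top.
Proof. by rewrite /top mulrC divfK// subr_eq0 gt_eqF. Qed.

Lemma fixpt_ge0 d : 0 <= fixpt d.
Proof. by rewrite divr_ge0// subr_ge0 ltW. Qed.

Lemma fixpt_le_top d : fixpt d <= top.
Proof.
by rewrite ler_pM2r ?invr_gt0 ?subr_gt0// ler_nat -ltnS.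
Qed.

Lemma exists_digit u v y : u + 1 <= v -> u <= y <= v + M%:R ->
  exists d, u <= y - (d : nat)%:R <= v.
Proof.
move=> uv huv.
suff [m lemM hm] : exists2 m, (m <= M)%N & u <= y - m%:R <= v.
  by exists (Ordinal (lemM : (m < M.+1)%N)).
elim: M huv => [|m IH] /andP[uy yv].
  by exists 0%N => //; rewrite subr0; lra.
have [yle|ylt] := leP y (v + m%:R).
  have [|i im hi] := IH; first by rewrite uy yle.
  by exists i => //; exact: leqW.
exists m.+1 => //; move: yv ylt; rewrite -natr1 => *; lra.
Qed.

Lemma beta_lt2 : beta < 2.
Proof. by have := (beta_gt1, beta_golden); rewrite expr2 => -[b1 bg]; nra. Qed.

(** Pulling [[u, v]] back by all digits gives the intervals
    [[(u + d)/beta, (v + d)/beta]]; they overlap as [v - u >= 1], and their union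
    [[u/beta, (v + M)/beta]] again has length at least 1.  Iterating, the two ends
    approach 0 and [top] geometrically, which is what the two hypotheses
    on [y] express. *)
Lemma reach n u v y : u + 1 <= v ->
  u <= y * beta ^+ n -> top - v <= (top - y) * beta ^+ n ->
  exists w, size w = n /\ u <= run y w <= v.
Proof.
elim: n u v => [|n IH] u v uv hu hv.
  exists [::]; split => //=; move: hu hv; rewrite expr0 !mulr1 => *.
  by apply/andP; split; lra.
have [b1 b0] : 1 < beta /\ 0 < beta by rewrite beta_gt1 (lt_trans ltr01 beta_gt1).
have [||| w [sw /andP[w1 w2]]] := IH (u / beta) ((v + M%:R) / beta).
- rewrite -(ler_pM2r b0) mulrDl !divfK ?gt_eqF// mul1r.
  have M1 : 1 <= M%:R :> R by rewrite ler1n.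
  have b2 := beta_lt2; lra.
- by rewrite ler_pdivrMr// -mulrA -exprSr.
- rewrite -(ler_pM2r b0) mulrBl divfK ?gt_eqF//.
  rewrite -[(top - y) * _ * _]mulrA -exprSr top_fixpt.
  by apply: le_trans hv; lra.
have [|d hd] := @exists_digit u v (beta * run y w) uv.
  move: w1 w2; rewrite ler_pdivrMr// ler_pdivlMr// => *; apply/andP; split; lra.
by exists (rcons w d); rewrite size_rcons sw run_rcons.
Qed.

(** * Balancing two digits *)

(** The invariant of the two-digit game, where [i] and [j] count the digits [p]
    and [q] played so far and [y] is the current point.  Playing [p] multiplies
    [y - fixpt p] by [beta], and playing [q] does so to [fixpt q - y]; hence
    [beta ^ (i - j) (fixpt q - y)] is unchanged by [q] and
    [beta ^ (j - i) (y - fixpt p)] by [p].  Bounding both from below bounds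
    [i - j] on both sides and keeps [y] away from the two fixed points. *)
Definition balanced A p q (i j : nat) y :=
  A * beta ^+ j <= beta ^+ i * (fixpt q - y) /\
  A * beta ^+ i <= beta ^+ j * (y - fixpt p).

(** Let [l < r] be the points with expansions [(pq)^oo] and [(qp)^oo], digits read
    from the left with [p] first for [l].  On the right of [r] playing [q] preserves
    the invariant, since there [q] followed by [p] moves the point away from
    [fixpt p]; symmetrically for [p] on the left of [l].  If [y <= r] and [p] is
    ahead, then [p] may be played: the new distance to [fixpt q] is at least [A]
    by the hypothesis on [A], and the weight [beta ^ (i - j)] is at least 1. *)
Lemma balanced_step A p q i j y : (p < q)%N -> 0 < A ->
  A * (beta ^+ 2 - 1) <= beta + 1 - beta ^+ 2 ->
  balanced A p q i j y ->
  balanced A p q i.+1 j (step y p) \/ balanced A p q i j.+1 (step y q).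
Proof.
have b1 := beta_gt1; have bg := beta_golden.
move=> pq A0 Agap; rewrite /balanced /step !exprS.
have P0 : 0 < beta ^+ i by rewrite exprn_gt0//; lra.
have Q0 : 0 < beta ^+ j by rewrite exprn_gt0//; lra.
have Bij : (beta ^+ j <= beta ^+ i) \/ (beta ^+ i <= beta ^+ j).
  by case: (leP (beta ^+ j) (beta ^+ i)) => [|/ltW]; [left|right].
move: Bij P0 Q0; set P := beta ^+ i; set Q := beta ^+ j => Bij P0 Q0.
have pqR : (p : nat)%:R + 1 <= (q : nat)%:R :> R by rewrite natr1 ler_nat.
move: (digit_fixpt p) (digit_fixpt q) pqR.
set a := fixpt p; set b := fixpt q; move: (p : nat)%:R (q : nat)%:R => p' q'.
move=> -> -> pqR [hb ha].
have b20 : 0 < beta ^+ 2 - 1 by nra.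
(* [xi] and [eta] are the distances to the fixed points of the digit that is
   played and of the other one; the condition on [xi] says that the point is
   not beyond the far end of the interval [[l, r]]. *)
have ahead P' Q' xi eta : 0 < P' -> Q' <= P' -> xi + eta = b - a ->
    (beta ^+ 2 - 1) * xi <= beta * ((beta - 1) * (b - a)) ->
    A * Q' <= beta * P' * (beta * eta - (beta - 1) * (b - a)).
  move=> P'0 QP xe hxi.
  have gap : A <= beta * eta - (beta - 1) * (b - a).
    rewrite -(ler_pM2r b20).
    have : (beta + 1 - beta ^+ 2) * 1 <=
           (beta + 1 - beta ^+ 2) * ((beta - 1) * (b - a)).
      by rewrite ler_pM2l; lra.
    have -> : eta = b - a - xi by rewrite -xe; ring.
    nra.
  have AQ : A * Q' <= A * P' by rewrite ler_pM2l.
  have AP : A * P' <= (beta * eta - (beta - 1) * (b - a)) * P'.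
    by rewrite ler_pM2r.
  have : 0 <= (beta - 1) * P' * (beta * eta - (beta - 1) * (b - a)).
    by rewrite !mulr_ge0//; lra.
  nra.
(* Beyond that end the other digit is played, and the distance [xi] to the fixed
   point of the idle digit shrinks by at most the factor [beta] that the weight
   gains. *)
have beyond P' Q' xi eta : 0 < P' -> A * Q' <= P' * xi ->
    beta * ((beta - 1) * (b - a)) <= (beta ^+ 2 - 1) * xi ->
    A * Q' <= beta * P' * (beta * xi - (beta - 1) * (b - a)).
  move=> P'0 hA hxi; apply: le_trans hA _.
  rewrite [beta * P']mulrC -mulrA ler_pM2l//; lra.
have rp : b - (beta * y - (beta - 1) * a) = beta * (b - y) - (beta - 1) * (b - a).
  by ring.
have rq : beta * y - (beta - 1) * b - a = beta * (y - a) - (beta - 1) * (b - a).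
  by ring.
have keep_p : A * (beta * P) <= Q * (beta * y - (beta - 1) * a - a).
  have -> : beta * y - (beta - 1) * a - a = beta * (y - a) by ring.
  by rewrite !(mulrCA _ beta) ler_pM2l//; lra.
have keep_q : A * (beta * Q) <= P * (b - (beta * y - (beta - 1) * b)).
  have -> : b - (beta * y - (beta - 1) * b) = beta * (b - y) by ring.
  by rewrite !(mulrCA _ beta) ler_pM2l//; lra.
case: Bij => hPQ.
  have [le_r|/ltW ge_r] :=
    leP ((beta ^+ 2 - 1) * (y - a)) (beta * ((beta - 1) * (b - a))).
    by left; split; [rewrite rp; apply: (ahead _ _ (y - a)) => //; ring|].
  by right; split; [|rewrite rq; apply: beyond].
have [le_l|/ltW ge_l] :=
  leP ((beta ^+ 2 - 1) * (b - y)) (beta * ((beta - 1) * (b - a))).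
  by right; split; [|rewrite rq; apply: (ahead _ _ (b - y)) => //; ring].
by left; split; [rewrite rp; apply: beyond|].
Qed.

Lemma balanced_word A p q y n : (p < q)%N -> 0 < A ->
  A * (beta ^+ 2 - 1) <= beta + 1 - beta ^+ 2 ->
  A <= fixpt q - y -> A <= y - fixpt p ->
  exists w i j, [/\ size w = n, (i + j)%N = n, balanced A p q i j (run y w) &
    forall k, count_mem k w = (i * (p == k) + j * (q == k))%N].
Proof.
move=> pq A0 Agap hq hp; elim: n => [|n [w [i [j [sw ij bal cw]]]]].
  exists [::], 0%N, 0%N; split=> //; split; rewrite expr0 /=; lra.
have [bal'|bal'] := balanced_step pq A0 Agap bal.
  exists (rcons w p), i.+1, j; rewrite run_rcons size_rcons sw; split=> //.
    by rewrite addSn ij.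
  by move=> k; rewrite -cats1 count_cat cw /=; lia.
exists (rcons w q), i, j.+1; rewrite run_rcons size_rcons sw; split=> //.
  by rewrite addnS ij.
by move=> k; rewrite -cats1 count_cat cw /=; lia.
Qed.

(** * Visiting all digits *)

Definition core eps y := eps <= y <= top - eps.

(** The first [t] steps bring [y] between the fixed points of [p] and [q], at
    distance at least [A] from both; the next [n] steps use [p] and [q]
    in a balanced way.  Neither [t] nor the error [K] depends on [y] or [n].
    The product of the two bounds in the invariant shows that the distances from
    the final point to the two fixed points have product at least [A ^ 2],
    so each is at least [A ^ 2 / top]. *)
Lemma phase_lt A eps (t K : nat) p q y n : (p < q)%N -> 0 < A ->
  A * (beta ^+ 2 - 1) <= beta + 1 - beta ^+ 2 ->
  (beta - 1) * (1 + 2 * A) <= 1 ->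
  eps * top <= A ^+ 2 -> top <= eps * beta ^+ t -> top <= A * beta ^+ K ->
  core eps y -> exists w, [/\ size w = (t + n)%N, core eps (run y w) &
    forall k, (2 * count_mem k w <= n * ((p == k) + (q == k)) + (K + 2 * t) /\
               n * ((p == k) + (q == k)) <= 2 * count_mem k w + (K + 2 * t))%N].
Proof.
have b1 := beta_gt1.
move=> pq A0 Agap A2 hepsA hepst hAK /andP[y1 y2].
have topp := fixpt_le_top q; have p0 := fixpt_ge0 p.
have d1 : 1 <= (beta - 1) * (fixpt q - fixpt p).
  by rewrite mulrBr -!digit_fixpt lerBrDr addrC natr1 ler_nat.
have d2 : 1 + 2 * A <= fixpt q - fixpt p.
  by rewrite -(@ler_pM2l _ (beta - 1)); lra.
have bt : 0 < beta ^+ t by rewrite exprn_gt0//; lra.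
have [||| w1 [sw1 /andP[h1 h2]]] :=
    @reach t (fixpt p + A) (fixpt q - A) y; first lra.
- apply: le_trans (_ : eps * beta ^+ t <= _); [lra|by rewrite ler_pM2r].
- apply: le_trans (_ : eps * beta ^+ t <= _); [lra|rewrite ler_pM2r//; lra].
have [||w2 [i [j [sw2 ij [balq balp] cw2]]]] :=
    @balanced_word A p q (run y w1) n pq A0 Agap; [lra|lra|].
have P0 : 0 < beta ^+ i by rewrite exprn_gt0//; lra.
have Q0 : 0 < beta ^+ j by rewrite exprn_gt0//; lra.
set z := run (run y w1) w2 in balq balp.
have xi0 : 0 < z - fixpt p.
  by rewrite -(pmulr_rgt0 _ Q0); apply: lt_le_trans balp; rewrite mulr_gt0.
have eta0 : 0 < fixpt q - z.
  by rewrite -(pmulr_rgt0 _ P0); apply: lt_le_trans balq; rewrite mulr_gt0.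
have prod : A ^+ 2 <= (z - fixpt p) * (fixpt q - z).
  rewrite -(ler_pM2r P0) expr2 -mulrA.
  apply: le_trans (_ : A * (beta ^+ j * (z - fixpt p)) <= _).
    by rewrite ler_pM2l.
  rewrite mulrA [_ * (z - _)]mulrC -[in leRHS]mulrA ler_pM2l// [leRHS]mulrC.
  exact: balq.
have close a b : (beta ^+ a * A <= beta ^+ b * top) -> (a <= b + K)%N.
  move=> hab; rewrite -(ler_eXn2l b1) exprD -(ler_pM2r A0) -mulrA.
  apply: le_trans hab _; rewrite ler_pM2l ?exprn_gt0//; last lra.
  by rewrite mulrC.
have ijK : (i <= j + K)%N.
  apply: close; rewrite mulrC; apply: le_trans balp _.
  by rewrite ler_pM2l//; lra.
have jiK : (j <= i + K)%N.
  apply: close; rewrite mulrC; apply: le_trans balq _.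
  by rewrite ler_pM2l//; lra.
have tp : 0 < top by lra.
exists (w1 ++ w2); rewrite size_cat sw1 sw2 run_cat -/z; split => //.
  apply/andP; split.
    suff : eps <= z - fixpt p by lra.
    rewrite -(ler_pM2r tp); apply: le_trans hepsA _; apply: le_trans prod _.
    by rewrite ler_pM2l//; lra.
  suff : eps <= fixpt q - z by lra.
  rewrite -(ler_pM2r tp); apply: le_trans hepsA _; apply: le_trans prod _.
  by rewrite mulrC ler_pM2l//; lra.
move=> k; rewrite count_cat cw2; have := count_size (pred1 k) w1; rewrite sw1.
have : ~~ ((p == k) && (q == k)).
  by apply/negP => /andP[/eqP pk /eqP qk]; move: pq; rewrite pk qk ltnn.
move: (count _ w1) (p == k) (q == k) ij ijK jiK; clear.
by move=> c [] [] //= ij ijK jiK _ ct; rewrite ?(muln0, muln1, addn0, add0n); lia.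
Qed.

Lemma phase A eps (t K : nat) p q y n : p != q -> 0 < A ->
  A * (beta ^+ 2 - 1) <= beta + 1 - beta ^+ 2 ->
  (beta - 1) * (1 + 2 * A) <= 1 ->
  eps * top <= A ^+ 2 -> top <= eps * beta ^+ t -> top <= A * beta ^+ K ->
  core eps y -> exists w, [/\ size w = (t + n)%N, core eps (run y w) &
    forall k, (2 * count_mem k w <= n * ((p == k) + (q == k)) + (K + 2 * t) /\
               n * ((p == k) + (q == k)) <= 2 * count_mem k w + (K + 2 * t))%N].
Proof.
rewrite neq_ltn => /orP[pq|qp] A0 Agap A2 hepsA hepst hAK hy.
  exact: (phase_lt n pq A0 Agap A2 hepsA hepst hAK hy).
have [w [sw cw hw]] :=
  phase_lt n qp A0 Agap A2 hepsA hepst hAK hy.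
by exists w; split=> // k; rewrite (addnC (p == k)).
Qed.

(** Phases can follow one another because each of them starts and ends in the
    same set [P] of good points; the errors add up. *)
Lemma phase_list (P : R -> Prop) (t B : nat) n (ps : seq ('I_M.+1 * 'I_M.+1)) y :
  (forall p q y, p != q -> P y -> exists w, [/\ size w = (t + n)%N, P (run y w) &
    forall k, (2 * count_mem k w <= n * ((p == k) + (q == k)) + B /\
               n * ((p == k) + (q == k)) <= 2 * count_mem k w + B)%N]) ->
  all (fun pq => pq.1 != pq.2) ps -> P y ->
  exists w, [/\ size w = (size ps * (t + n))%N, P (run y w) &
    forall k (s := (\sum_(pq <- ps) ((pq.1 == k) + (pq.2 == k)))%N),
      (2 * count_mem k w <= n * s + size ps * B /\
       n * s <= 2 * count_mem k w + size ps * B)%N].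
Proof.
move=> hphase; elim: ps y => [|[p q] ps IH] y /= => [_ Py|/andP[pq hps] Py].
  by exists [::]; split=> // k; rewrite big_nil muln0.
have [w1 [sw1 Pw1 c1]] := hphase _ _ _ pq Py.
have [w2 [sw2 Pw2 c2]] := IH _ hps Pw1.
exists (w1 ++ w2); rewrite size_cat sw1 sw2 mulSn run_cat; split=> // k.
rewrite big_cons count_cat /= mulnDr; move: (c1 k) (c2 k) => /=.
move: (\sum_(_ <- _) _)%N (count _ w1) (count _ w2) => s a b; clear; lia.
Qed.

Lemma sum_cyclic_pairs k :
  (\sum_(pq <- [seq (p, ordS p) | p <- enum 'I_M.+1])
     ((pq.1 == k) + (pq.2 == k)))%N = 2%N.
Proof.
rewrite big_map big_enum /= big_split /=.
have one : (\sum_(p : 'I_M.+1) (p == k))%N = 1%N.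
  by rewrite (bigD1 k)//= eqxx big1 ?addn0// => p /negPf ->.
rewrite one (reindex_inj (can_inj (@ord_predK M.+1))) /= -[RHS]/(1 + 1)%N.
by congr (1 + _)%N; rewrite -[RHS]one; apply: eq_bigr => p _; rewrite ord_predK.
Qed.

Lemma neq_ordS p : p != ordS p.
Proof.
apply/eqP => /(congr1 val) /=; case: p => p /= pM.
have [pM'|] := ltnP p M; first by rewrite modn_small//; lia.
move=> Mp; have -> : p = M by lia.
by rewrite modnn; lia.
Qed.

(** Adjacent pairs in cyclic order treat every digit alike, whatever the parity
    of [M]; matching each digit [d] with [M - d] instead would leave out the
    middle one when [M] is even. *)
Lemma cycle_word (P : R -> Prop) (t B : nat) n y :
  (forall p q y, p != q -> P y -> exists w, [/\ size w = (t + n)%N, P (run y w) &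
    forall k, (2 * count_mem k w <= n * ((p == k) + (q == k)) + B /\
               n * ((p == k) + (q == k)) <= 2 * count_mem k w + B)%N]) ->
  P y ->
  exists w, [/\ size w = (M.+1 * (t + n))%N, P (run y w) &
    forall k, (count_mem k w <= n + M.+1 * B /\
               n <= count_mem k w + M.+1 * B)%N].
Proof.
move=> hphase Py.
have hps : all (fun pq => pq.1 != pq.2) [seq (p, ordS p) | p <- enum 'I_M.+1].
  by apply/allP => _ /mapP[p _ ->] /=; exact: neq_ordS.
have [w [sw Pw hw]] := phase_list hphase hps Py.
rewrite size_map size_enum_ord in sw hw.
exists w; split=> // k; move: (hw k); rewrite sum_cyclic_pairs.
move: (count _ w) (M.+1 * B)%N => c b; clear; lia.
Qed.

(** * Infinite sequences *)

(** Between the ends of cycles [n] and [n + 1] the discrepancy is at most the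
    accumulated error, linear in [n], plus the length of one cycle, linear
    in [n] too, whereas the position [N] is at least [n ^ 2 / 2]. *)
Lemma concatenation (P : R -> Prop) (t B : nat) x :
  (forall n y, P y ->
    exists w, [/\ size w = (M.+1 * (t + n))%N, P (run y w) &
    forall k, (count_mem k w <= n + B /\ n <= count_mem k w + B)%N]) ->
  P x ->
  exists (a : nat -> 'I_M.+1) (E : nat),
    (forall N, exists2 N', (N <= N')%N & P (run x (mkseq a N'))) /\
    (forall k N, exists n, [/\ (n ^ 2 <= 2 * N)%N,
       (M.+1 * count_mem k (mkseq a N) <= N + E * n.+1)%N &
       (N <= M.+1 * count_mem k (mkseq a N) + E * n.+1)%N]).
Proof.
move=> hblock Px.
have [W hW] : {W : R * nat -> seq 'I_M.+1 & forall yn, P yn.1 ->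
    [/\ size (W yn) = (M.+1 * (t + yn.2))%N, P (run yn.1 (W yn)) &
    forall k, (count_mem k (W yn) <= yn.2 + B /\
               yn.2 <= count_mem k (W yn) + B)%N]}.
  apply: (@choice _ _ (fun yn w => P yn.1 -> [/\ size w = (M.+1 * (t + yn.2))%N,
    P (run yn.1 w) & forall k, (count_mem k w <= yn.2 + B /\
       yn.2 <= count_mem k w + B)%N])) => -[y n] /=.
  have [/hblock-/(_ n)[w hw]|nP] := pselect (P y); first by exists w.
  by exists [::].
(* The concatenation of the first [n] cycles; the (n+1)-st cycle spends at least
   [n + 1] steps on each pair, so no cycle is empty. *)
pose pre := fix pre n := if n is m.+1 then pre m ++ W (run x (pre m), n) else [::].
have preP n : P (run x (pre n)).
  by elim: n => //= n IH; rewrite run_cat; have [] := hW (run x (pre n), n.+1) IH.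
have sizeS n : size (pre n.+1) = (size (pre n) + M.+1 * (t + n.+1))%N.
  by rewrite /= size_cat; have [->] := hW (run x (pre n), n.+1) (preP n).
have size_sq n : (n ^ 2 + n <= 2 * size (pre n))%N.
  elim: n => // n IH; rewrite sizeS mulSn; nia.
have size_ge n : (n <= size (pre n))%N by have := size_sq n; nia.
have nth_pre i m n : (m <= n)%N -> (i < size (pre m))%N ->
    nth ord0 (pre n) i = nth ord0 (pre m) i.
  move=> /subnK <-; elim: (n - m)%N => // j IH im.
  rewrite addSn /= nth_cat ifT ?IH//; apply: (leq_trans im).
  by elim: (j) => // j' /leq_trans; apply; rewrite addSn sizeS leq_addr.
pose a i := nth ord0 (pre i.+1) i.
have aE n N : (N <= size (pre n))%N -> mkseq a N = take N (pre n).
  move=> hN; apply: (@eq_from_nth _ ord0); rewrite size_mkseq ?size_takel//.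
  move=> i iN; rewrite nth_mkseq// nth_take// /a.
  have [le|/ltnW le] := leqP i.+1 n; first by rewrite (nth_pre _ _ _ le).
  by rewrite (nth_pre _ _ _ le)//; exact: leq_trans hN.
have count_pre k n :
    (M.+1 * count_mem k (pre n) <= size (pre n) + M.+1 * (B + t) * n)%N /\
    (size (pre n) <= M.+1 * count_mem k (pre n) + M.+1 * (B + t) * n)%N.
  elim: n => [|n IH]; first by rewrite /= muln0.
  rewrite sizeS /= count_cat.
  have [_ _ /(_ k)] /= := hW (run x (pre n), n.+1) (preP n).
  by move: (count _ _) (count _ (W _)) (size _) IH => c1 c2 s; clear; nia.
exists a, (M.+1 * (B + t) + M.+1 * M.+1 * t.+1)%N; split.
  by move=> N; exists (size (pre N)) => //; rewrite (aE N)// take_size; exact: preP.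
move=> k N.
have [n /andP[nN Nn]] : exists n, (size (pre n) <= N < size (pre n.+1))%N.
  elim: N => [|N [n /andP[nN Nn]]].
    by exists 0%N; rewrite sizeS muln_gt0 addnS.
  have [ltN|leN] := ltnP N.+1 (size (pre n.+1)); first by exists n; rewrite ltN leqW.
  exists n.+1; rewrite leN /=; apply: (leq_ltn_trans Nn).
  by rewrite (sizeS n.+1) -[X in (X < _)%N]addn0 ltn_add2l muln_gt0 addnS.
pose rest := take (N - size (pre n)) (W (run x (pre n), n.+1)).
have cN : mkseq a N = pre n ++ rest.
  by rewrite (aE n.+1) 1?ltnW//= take_cat ltnNge nN.
have : (size rest <= N - size (pre n))%N by rewrite size_take_min geq_minl.
move=> /(leq_trans (count_size (pred1 k) rest)).
move: (count_pre k n) Nn (size_sq n) nN.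
rewrite cN count_cat sizeS /=.
move: (count _ (pre n)) => c1; move: (count _ rest) => c2; clear rest cN.
move: (size (pre n)) => s; clear => -[h1 h2] h3 h4 h5 h6.
have c2N : (c2 <= M.+1 * (t + n.+1))%N by lia.
have c2M : (M.+1 * c2 <= M.+1 * M.+1 * (t + n.+1))%N by rewrite -mulnA leq_mul2l c2N.
have e1 : (M.+1 * (t + n.+1) <= M.+1 * M.+1 * t.+1 * n.+1)%N.
  rewrite -!mulnA leq_mul2l /=; nia.
have e2 : (M.+1 * M.+1 * (t + n.+1) <= M.+1 * M.+1 * t.+1 * n.+1)%N.
  rewrite -!mulnA !leq_mul2l /=; nia.
have e3 : (M.+1 * (B + t) * n <= M.+1 * (B + t) * n.+1)%N.
  by rewrite leq_mul2l leqnSn orbT.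
exists n; rewrite (mulnDr M.+1 c1 c2) (mulnDl _ _ n.+1); split; first lia.
  apply: leq_trans (leq_add h1 c2M) _; lia.
lia.
Qed.

(** An orbit that has left [[0, top]] never comes back, so it is enough to check
    infinitely many of its points. *)
Lemma run_range y w : 0 <= run y w <= top -> 0 <= y <= top.
Proof.
have b1 := beta_gt1; have b0 : 0 < beta by lra.
elim: w y => // d w IH y /IH /andP[]; rewrite /step => h1 h2.
have dM : (d : nat)%:R <= M%:R :> R by rewrite ler_nat -ltnS.
have d0 : 0 <= (d : nat)%:R :> R by [].
have tE := top_fixpt.
have : 0 <= beta * y by lra.
have : beta * y <= beta * top by lra.
by rewrite pmulr_rge0// ler_pM2l// => -> ->.
Qed.

Lemma run_series x (a : nat -> 'I_M.+1) N :
  series (fun i : nat => (a i : nat)%:R / beta ^+ i.+1) N =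
  x - run x (mkseq a N) * beta^-1 ^+ N.
Proof.
have b0 : beta != 0 by rewrite gt_eqF// (lt_trans ltr01).
elim: N => [|N IH]; first by rewrite /series /= big_geq// expr0 mulr1 subrr.
rewrite seriesSr IH mkseqS run_rcons /step !exprVn !exprS.
have bN : beta ^+ N != 0 by rewrite expf_neq0.
by field; rewrite b0 bN.
Qed.

Lemma run_expansion x (a : nat -> 'I_M.+1) :
  (forall N, 0 <= run x (mkseq a N) <= top) -> is_beta_expansion beta x a.
Proof.
move=> h; rewrite /is_beta_expansion.
rewrite (_ : series _ = fun N => x - run x (mkseq a N) * beta^-1 ^+ N); last first.
  by apply/funext => N; exact: run_series.
have b0 : 0 < beta by rewrite (lt_trans ltr01).
have geo : (fun N => top * beta^-1 ^+ N) @ \oo --> (0 : R).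
  apply: cvg_geometric; rewrite ger0_norm ?invr_ge0 ?ltW//.
  by rewrite invf_lt1.
have lo : (fun N => x - top * beta^-1 ^+ N) @ \oo --> x.
  by rewrite -[X in _ --> X]subr0; apply: cvgB => //; exact: cvg_cst.
apply: (@squeeze_cvgr _ _ _ _ (fun N => x - top * beta^-1 ^+ N) (fun=> x)) => //;
  last exact: cvg_cst.
apply: nearW => N; have /andP[r0 r1] := h N.
have bN : 0 < beta^-1 ^+ N by rewrite exprn_gt0// invr_gt0.
by rewrite lerD2l lerN2 ler_pM2r// r1 /= gerBl mulr_ge0// ltW.
Qed.

Lemma freq_ratioE (a : nat -> 'I_M.+1) k N :
  freq_ratio R a k N = (count_mem k (mkseq a N))%:R / N%:R.
Proof.
rewrite /freq_ratio; congr (_%:R / _).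
rewrite cardsE cardE size_filter /mkseq count_map -val_enum_ord count_map.
by rewrite enumT; apply: eq_count => i.
Qed.

(** The hypothesis bounds the discrepancy at [N] by a multiple of [sqrt N]. *)
Lemma simply_normal_of_discrepancy (a : nat -> 'I_M.+1) (E : nat) :
  (forall k N, exists n, [/\ (n ^ 2 <= 2 * N)%N,
       (M.+1 * count_mem k (mkseq a N) <= N + E * n.+1)%N &
       (N <= M.+1 * count_mem k (mkseq a N) + E * n.+1)%N]) ->
  simply_normal R a.
Proof.
move=> h k.
suff cv : freq_ratio R a k @ \oo --> (M.+1%:R^-1 : R).
  by split; [apply/cvg_ex; exists M.+1%:R^-1 | exact: cvg_lim cv].
apply/cvgrPdist_le => e e0; near=> N.
have [n [nN h1 h2]] := h k N.
have N0 : (0 < N)%N by near: N; exists 1%N.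
have NE : 8 * E%:R ^+ 2 <= e ^+ 2 * N%:R :> R.
  rewrite -ler_pdivrMl ?exprn_gt0//.
  near: N; exact: nbhs_infty_ger.
rewrite freq_ratioE; move: (count _ _) h1 h2 => c h1 h2.
(* The factor 8 also covers the first cycle, where [n = 0] and [N >= 1]. *)
have n8 : ((n.+1) ^ 2 <= 8 * N)%N by clear -nN N0; nia.
have n8R : n.+1%:R ^+ 2 <= 8 * N%:R :> R by rewrite -natrX -natrM ler_nat.
have NR : 0 < N%:R :> R by rewrite ltr0n.
have dev : E%:R * n.+1%:R <= e * N%:R.
  rewrite -ler_sqr ?nnegrE ?mulr_ge0 ?(ltW e0)// !exprMn.
  apply: le_trans (_ : E%:R ^+ 2 * (8 * N%:R) <= _).
    by rewrite ler_wpM2l// exprn_ge0.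
  by rewrite expr2 in NE *; nra.
have {}h1 : M.+1%:R * c%:R <= N%:R + e * N%:R :> R.
  apply: (@le_trans _ _ (N%:R + E%:R * n.+1%:R)); last by rewrite lerD2l.
  by rewrite -!natrM -natrD ler_nat.
have {}h2 : N%:R <= M.+1%:R * c%:R + e * N%:R :> R.
  apply: (@le_trans _ _ (M.+1%:R * c%:R + E%:R * n.+1%:R)); last by rewrite lerD2l.
  by rewrite -!natrM -natrD ler_nat.
have m1 : 1 <= M.+1%:R :> R by rewrite ler1n.
move: (M.+1%:R : R) (N%:R : R) (c%:R : R) m1 NR h1 h2 => m r c' m1 r0 h1 h2.
have mr : 0 < m * r by rewrite mulr_gt0//; lra.
have -> : m^-1 - c' / r = (r - m * c') / (m * r).
  by field; rewrite !gt_eqF//; lra.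
rewrite normrM normfV (gtr0_norm mr) ler_pdivrMr//.
have : e * r <= e * (m * r) by rewrite ler_pM2l// ler_peMl// ltW.
by rewrite ler_norml => h3; apply/andP; split; lra.
Unshelve. all: by end_near. Qed.

Lemma expr_unbounded z c : 0 < c -> exists n, z <= c * beta ^+ n.
Proof.
move=> c0; have b1 := beta_gt1.
have bernoulli n : 1 + (beta - 1) * n%:R <= beta ^+ n.
  elim: n => [|n IH]; first by rewrite mulr0 addr0 expr0.
  have sq0 : 0 <= (beta - 1) * (beta - 1) * n%:R by rewrite !mulr_ge0//; lra.
  have : beta * (1 + (beta - 1) * n%:R) <= beta * beta ^+ n.
    by rewrite ler_pM2l//; lra.
  by rewrite exprS -natr1; lra.
have r0 : 0 < c * (beta - 1) by rewrite mulr_gt0//; lra.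
exists (Num.bound `|z / (c * (beta - 1))|); set n := Num.bound _.
have : `|z / (c * (beta - 1))| < n%:R by exact: archi_boundP.
move=> /ltW /(le_trans (ler_norm _)); rewrite ler_pdivrMr// => zn.
apply: (le_trans zn); rewrite mulrCA ler_pM2l//.
by apply: le_trans (bernoulli n); rewrite mulrC; lra.
Qed.

Lemma exists_simply_normal x : 0 < x < top ->
  exists a : nat -> 'I_M.+1, is_beta_expansion beta x a /\ simply_normal R a.
Proof.
move=> /andP[x0 xtop]; have b1 := beta_gt1; have bg := beta_golden.
have b2 := beta_lt2; have top0 : 0 < top by lra.
have b20 : 0 < beta ^+ 2 - 1 by nra.
have bm0 : 0 < beta - 1 by lra.
(* The first term is the slack left by the golden ratio; the second leaves an
   interval of length 1 between two fixed points after removing [A] at each end,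
   which is the length needed to steer into it. *)
pose A := Num.min ((beta + 1 - beta ^+ 2) / (beta ^+ 2 - 1))
                  (((beta - 1)^-1 - 1) / 2).
have A0 : 0 < A.
  rewrite lt_min; apply/andP; split; apply: divr_gt0 => //; first lra.
  by rewrite subr_gt0 invf_gt1//; lra.
have Agap : A * (beta ^+ 2 - 1) <= beta + 1 - beta ^+ 2.
  by rewrite -ler_pdivlMr// /A ge_min lexx.
have A2 : (beta - 1) * (1 + 2 * A) <= 1.
  have : A <= ((beta - 1)^-1 - 1) / 2 by rewrite /A ge_min lexx orbT.
  by rewrite -ler_pdivlMl// mulr1; lra.
(* [A ^ 2 / top] is the margin with which a phase ends. *)
pose eps := Num.min (A ^+ 2 / top) (Num.min x (top - x)).
have eps0 : 0 < eps by rewrite !lt_min divr_gt0 ?exprn_gt0// x0 subr_gt0.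
have hepsA : eps * top <= A ^+ 2.
  by rewrite -ler_pdivlMr// /eps ge_min lexx.
have corex : core eps x.
  have h1 : eps <= x by rewrite /eps !ge_min lexx orbT.
  have h2 : eps <= top - x by rewrite /eps !ge_min lexx !orbT.
  by apply/andP; split; lra.
have [t ht] := expr_unbounded top eps0; have [K hK] := expr_unbounded top A0.
have [n y|a [E [hcore hfreq]]] :=
    @concatenation (core eps) t (M.+1 * (K + 2 * t)) x _ corex.
  apply: (@cycle_word (core eps) t (K + 2 * t)) => p q z pq.
  exact: (phase n pq A0 Agap A2 hepsA ht hK).
exists a; split; last exact: simply_normal_of_discrepancy hfreq.
apply: run_expansion => N; have [N' /subnKC NN' /andP[c1 c2]] := hcore N.
apply: (@run_range _ (map a (iota N (N' - N)))).
have -> : run (run x (mkseq a N)) (map a (iota N (N' - N))) = run x (mkseq a N').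
  by rewrite -run_cat /mkseq -map_cat -[in iota N _](add0n N) -iotaD NN'.
by apply/andP; split; lra.
Qed.

End Expansions.

Theorem corollary1p3 (R : realType) (M : nat) (beta : R)
    (hM : (0 < M)%N)
    (hbeta : 1 < beta < (1 + Num.sqrt 5) / 2)
    (x : R) (hx : 0 < x < M%:R / (beta - 1)) :
  exists a : nat -> 'I_M.+1,
    is_beta_expansion beta x a /\ simply_normal R a.
Proof.
move: hbeta => /andP[b1 bs].
apply: exists_simply_normal => //.
(* [beta ^ 2 < beta + 1] says that [2 beta - 1 < sqrt 5]. *)
have : Num.sqrt 5 ^+ 2 = 5 :> R by rewrite sqr_sqrtr.
move: (Num.sqrt 5) (@sqrtr_ge0 R 5) bs => s s0 bs; rewrite !expr2 => s5.
nra.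
Qed.
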